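(* Let $P$ be a finite poset of dimension $d\ge 1$ with nonzero Euler characteristic $\chi(P)\neq 0$. For $k\ge 0$ let $\beta_1^{(k)},\dots,\beta_d^{(k)}$ be the zeros (with multiplicity) of the rational function $Z_{\mathrm{Sd}^k(P)}(s)$, labelled so that $|\beta_1^{(k)}|=\max\{|\beta_1^{(k)}|,\dots,|\beta_d^{(k)}|\}$. Then, as $k\to\infty$, $|\beta_1^{(k)}|$ diverges to $\infty$ and the other zeros $\beta_2^{(k)},\dots,\beta_d^{(k)}$ converge (i.e. they can be labelled so that each converges to a finite limit). In particular, $\beta_1^{(k)}$ is real for all sufficiently large $k$, and the product $\prod_{i=2}^d\beta_i^{(k)}$ converges to $(-1)^{d-1}$.
   Context: For a finite poset $P$: $N_i(P)$ is the set of chains $x_0\le x_1\le\cdots\le x_i$ in $P$ (equalities allowed), and $\overline{N_i}(P)$ is the set of strict chains $x_0<x_1<\cdots<x_i$. The dimension of $P$ is the largest $i$ with $\overline{N_i}(P)\neq\emptyset$, and the Euler characteristic is $\chi(P)=\sum_{i=0}^{\dim P}(-1)^i\#\overline{N_i}(P)$. The zeta series is $Z_P(s)=\sum_{i\ge 0}\#N_i(P)s^i$; it is a rational function of $s$, and its zeros are meant as zeros of this rational function. The barycentric subdivision $\mathrm{Sd}(P)$ is the poset whose elements are the nonempty totally ordered subsets (strict chains) of $P$, ordered by inclusion; $\mathrm{Sd}^k$ denotes its $k$-fold iterate. *)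

(* Defs.v *)
From HB Require Import structures.
From mathcomp Require Import all_boot all_order all_algebra.
From mathcomp Require Import complex.
From mathcomp Require Import all_classical all_reals all_analysis.

Set Implicit Arguments.
Unset Strict Implicit.
Unset Printing Implicit Defensive.

Import Order.TTheory GRing.Theory Num.Theory.
Import numFieldNormedType.Exports.

Local Open Scope ring_scope.

Section Posets.
Context {disp : Order.disp_t}.
Implicit Type P : finPOrderType disp.

(* N_i(P): the multichains x_0 <= ... <= x_i (i.+1 entries) *)
Definition multichains P (i : nat) : {set i.+1.-tuple P} :=
  [set t : i.+1.-tuple P | sorted <=%O t].

(* \overline{N_i}(P): the strict chains x_0 < ... < x_i *)
Definition strict_chains P (i : nat) : {set i.+1.-tuple P} :=
  [set t : i.+1.-tuple P | sorted <%O t].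

(* The maximum may be taken over i < #|P| because the i.+1 entries of a strict
   chain are pairwise distinct. *)
Definition poset_dim P : nat :=
  \max_(i < #|P| | strict_chains P i != finset.set0) i.

Definition euler_char P : int :=
  \sum_(i < (poset_dim P).+1) (-1) ^+ i * #|strict_chains P i|%:Z.

Definition is_chain P (A : {set P}) : bool :=
  (A != finset.set0) && [forall x in A, forall y in A, (x >=< y)%O].

Record sd_type P := SdType { sd_val : {set P}; _ : is_chain sd_val }.

HB.instance Definition _ P := [isSub for @sd_val P].
HB.instance Definition _ P := [Finite of sd_type P by <:].

Definition sd_le P : rel (sd_type P) := fun A B => sd_val A \subset sd_val B.

Lemma sd_le_refl P : reflexive (@sd_le P).
Proof. by move=> A; apply: subxx. Qed.

Lemma sd_le_anti P : antisymmetric (@sd_le P).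
Proof. by move=> A B sAB; apply/val_inj/eqP; rewrite finset.eqEsubset. Qed.

Lemma sd_le_trans P : transitive (@sd_le P).
Proof. by move=> B A C; apply: fintype.subset_trans. Qed.

(* The subdivision keeps the display of P so that Sd can be iterated. *)
HB.instance Definition _ P := Order.Le_isPOrder.Build disp (sd_type P)
  (@sd_le_refl P) (@sd_le_anti P) (@sd_le_trans P).

Definition Sd P : finPOrderType disp := sd_type P.

Lemma le_SdE P (A B : Sd P) : (A <= B)%O = (sd_val A \subset sd_val B).
Proof. by []. Qed.

Definition iter_Sd (k : nat) P : finPOrderType disp := iter k Sd P.

End Posets.

Section RationalFunctions.
Variable C : fieldType.
Implicit Types (f : {fraction {poly C}}) (a : nat -> C) (s : seq C).

(* f is the rational function with power series a_0 + a_1 s + a_2 s^2 + ...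
   at 0: f = p / q with q(0) != 0 and p = (\sum_i a_i s^i) q as power series. *)
Definition has_expansion f a : Prop :=
  exists p q : {poly C},
    [/\ q`_0 != 0, f = tofrac p / tofrac q
      & forall n, p`_n = \sum_(i < n.+1) a i * q`_(n - i)].

(* s lists the zeros of f with multiplicity, i.e. those of the numerator of f
   in lowest terms; this forces f != 0. *)
Definition zeros_of f s : Prop :=
  exists p q : {poly C},
    [/\ q != 0, coprimep p q, f = tofrac p / tofrac q
      & p %= \prod_(z <- s) ('X - z%:P)].

Definition is_zeta_function {disp : Order.disp_t} (P : finPOrderType disp) f :=
  has_expansion f (fun i => #|multichains P i|%:R).

Definition zeta_zeros {disp : Order.disp_t} (P : finPOrderType disp) s :=
  exists2 Z, is_zeta_function P Z & zeros_of Z s.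

End RationalFunctions.

(* R[i] with its numClosedFieldType structure made explicit, through which the
   topology of a numFieldType is found. *)
Definition cplx (R : realType) : numClosedFieldType := R[i].

(* b 1, ..., b d are the zeros of Z_P, with b 1 of maximal modulus; the values
   of b outside this range are irrelevant. *)
Definition labelled_zeros (R : realType) {disp : Order.disp_t}
    (P : finPOrderType disp) (d : nat) (b : nat -> cplx R) : Prop :=
  zeta_zeros P [seq b i | i <- index_iota 1 d.+1] /\
  forall i, (1 <= i <= d)%N -> `|b i| <= `|b 1%N|.

(* Main.v *)
(* Let c_j be the number of strict chains of P with j + 1 elements. Counting
   multichains by their support gives Z_P(s) = h(s) / (1 - s)^(d+1) with
   h(s) = \sum_j c_j s^j (1 - s)^(d-j), in lowest terms since h(1) = c_d != 0;
   its coefficient of s^d is (-1)^d chi(P). A multichain A_0 <= ... <= A_n in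
   Sd P with last term A is a map from A to {0, ..., n} taking the value 0, so
   Sd acts on (c_j) by a triangular matrix of surjection numbers, with diagonal
   entries (j + 1)!. This matrix preserves chi and, after normalisation by
   (d + 1)!^k, the iterates converge to an eigenvector v for (d + 1)!.

   Put q(t) = \sum_j v_j t^(j+1). Replacing each t^j by the binomial polynomial
   C(x, j) is inverse to the action of Sd and commutes with t |-> -1 - t, and
   the eigenvalue (d + 1)! is simple, so q(-1 - t) = (-1)^(d+1) q(t). For the
   limit H of the normalised numerators this says that H is palindromic of
   degree d - 1. Hence exactly one zero escapes to infinity, the others converge
   to the zeros of H, whose product is (-1)^(d-1) H(0) / H(0), and the escaping
   zero, being alone of its modulus, equals its complex conjugate. *)
From HB Require Import structures.
Require Import Defs.
From mathcomp Require Import all_boot all_order all_algebra.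
From mathcomp Require Import complex.
From mathcomp Require Import all_classical all_reals all_analysis.
From mathcomp Require Import zify ring lra.
Set Implicit Arguments.
Unset Strict Implicit.
Unset Printing Implicit Defensive.
Import Order.TTheory GRing.Theory Num.Theory.
Import numFieldNormedType.Exports.

(** * Counting chains and multichains *)

(** The number of [e]-paths with [n] steps starting at [x]; the recursion on the first step replaces
    tuples in the inductions. *)
Fixpoint walks (T : finType) (e : rel T) n x :=
  if n is m.+1 then \sum_(y | e x y) walks e m y else 1.

Lemma card_path_walks (T : finType) (e : rel T) n x :
  #|[set t : n.-tuple T | path e x t]| = walks e n x.
Proof.
elim: n x => [|n IHn] x /=.
  by apply: (fintype.eq_card1 (x := [tuple])) => t; rewrite !inE tuple0.
under eq_bigr do rewrite -IHn -sum1dep_card.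
rewrite pair_big_dep -sum1dep_card /=.
rewrite (reindex (fun p : T * n.-tuple T => [tuple of p.1 :: p.2])) //=.
by exists (fun t => (thead t, [tuple of behead t])) => [[y t]|t] _;
  [congr pair; apply/val_inj | rewrite [RHS]tuple_eta; apply/val_inj].
Qed.

Lemma card_sorted_walks (T : finType) (e : rel T) n :
  #|[set t : n.+1.-tuple T | sorted e t]| = \sum_x walks e n x.
Proof.
under eq_bigr do rewrite -card_path_walks -sum1dep_card.
rewrite pair_big_dep -sum1dep_card /=.
rewrite (reindex (fun p : T * n.-tuple T => [tuple of p.1 :: p.2])) //=.
by exists (fun t => (thead t, [tuple of behead t])) => [[y t]|t] _;
  [congr pair; apply/val_inj | rewrite [RHS]tuple_eta; apply/val_inj].
Qed.

(** Reversal makes the walks descend: in [Sd P] the number of multichains with a given top term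
    depends only on the size of that term. *)
Lemma card_sorted_walks_rev (T : finType) (e : rel T) n :
  #|[set t : n.+1.-tuple T | sorted e t]| =
  \sum_x walks (fun x y => e y x) n x.
Proof.
rewrite -card_sorted_walks -!sum1dep_card.
rewrite (reindex (fun t : n.+1.-tuple T => [tuple of rev t])) /=.
  by apply: eq_bigl => t; rewrite rev_sorted.
by exists (fun t : n.+1.-tuple T => [tuple of rev t]) => t _; apply/val_inj; rewrite /= revK.
Qed.

Lemma sum_bin_succ n (F : nat -> nat) :
  \sum_(j < n.+2) 'C(n.+1, j) * F j =
  \sum_(j < n.+1) 'C(n, j) * F j + \sum_(j < n.+1) 'C(n, j) * F j.+1.
Proof.
rewrite big_ord_recl bin0 /= [in RHS]big_ord_recl bin0 -addnA; congr (_ + _).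
under eq_bigr do rewrite binS mulnDl.
rewrite big_split /=; congr (_ + _).
by rewrite big_ord_recr /= bin_small // addn0.
Qed.

Section Chains.
Context {disp : Order.disp_t}.
Implicit Type P : finPOrderType disp.

Definition num_chains P j := #|strict_chains P j|.

(** A multichain is a strict chain together with the choice of the [j] steps, among [n], that are
    strict. The induction separates a first step that stays at [x] from one that moves up, and is
    Pascal's rule. *)
Lemma walks_le_lt P n (x : P) :
  walks <=%O n x = \sum_(j < n.+1) 'C(n, j) * walks <%O j x.
Proof.
elim: n x => [|n IHn] x; first by rewrite big_ord1.
rewrite (sum_bin_succ n (fun j => walks <%O j x)) -IHn /= (bigD1 x) //=.
congr (_ + _); under [RHS]eq_bigr do rewrite big_distrr /=.
rewrite exchange_big /=; apply: eq_big => [y|y _]; last exact: IHn.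
by rewrite andbC -lt_def.
Qed.

Lemma card_multichains P n :
  #|multichains P n| = \sum_(j < n.+1) 'C(n, j) * num_chains P j.
Proof.
rewrite card_sorted_walks.
under eq_bigr do rewrite walks_le_lt.
rewrite exchange_big; apply: eq_bigr => j _.
by rewrite -big_distrr /num_chains card_sorted_walks.
Qed.

Lemma sum_powerset (T : finType) (A : {set T}) y :
  \sum_(B : {set T} | B \subset A) y ^ #|B| = y.+1 ^ #|A|.
Proof.
rewrite (partition_big (fun B : {set T} => inord #|B| : 'I_#|A|.+1) xpredT) //=.
rewrite -[y.+1]add1n expnDn; apply: eq_bigr => i _.
rewrite exp1n mul1n -cards_draws -sum1dep_card big_distrl /=.
apply: eq_big => [B|B /andP[sBA /eqP<-]].
  case sBA: (B \subset A) => //=.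
  by rewrite -val_eqE /= inordK // ltnS subset_leq_card.
by rewrite mul1n inordK // ltnS subset_leq_card.
Qed.

Lemma sum_sd P (Q : pred {set P}) (F : {set P} -> nat) :
  \sum_(A : Sd P | Q (sd_val A)) F (sd_val A) =
  \sum_(A : {set P} | is_chain A && Q A) F A.
Proof.
pose h (A : {set P}) : option (Sd P) := insub A.
rewrite (reindex_omap (@sd_val _ P : Sd P -> _) h) /=; last first.
  by move=> A /andP[cA _]; rewrite /h insubT.
apply: eq_bigl => A; rewrite /h.
by rewrite (valP A) /= valK eqxx andbT.
Qed.

(** Sending each element of [A] to the stage at which it enters identifies these multichains with
    the maps from [A] to [{0,...,n}] that take the value 0. The maps avoiding 0 are added on the
    left rather than subtracted in [nat]. *)
Lemma walks_sd P n (A : Sd P) :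
  walks (fun A B : Sd P => (B <= A)%O) n A + n ^ #|sd_val A| =
  n.+1 ^ #|sd_val A|.
Proof.
have nonempty (B : Sd P) : 0 < #|sd_val B|.
  by rewrite card_gt0; case: B => B /= /andP[].
elim: n A => [|n IHn] A.
  by rewrite exp0n // exp1n.
(* The summand 1 accounts for the empty set, which is not an element of [Sd P]. *)
have subs y : \sum_(B : Sd P | (B <= A)%O) y ^ #|sd_val B| + 1 =
              y.+1 ^ #|sd_val A|.
  rewrite -sum_powerset (bigD1 finset.set0) ?finset.sub0set //= cards0 expn0 addnC.
  congr (_ + _).
  rewrite (sum_sd (fun B => B \subset sd_val A) (fun B => y ^ #|B|)).
  apply: eq_bigl => B; rewrite andbC /is_chain.
  case sBA: (B \subset _) => //=; case: (B =P _) => //= _.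
  apply/forall_inP => x Bx; apply/forall_inP => z Bz.
  have /andP[_ /forall_inP/(_ x) cA] := valP A.
  by apply: (forall_inP (cA _)); apply: (fintype.subsetP sBA).
have := subs n.+1; have := subs n.
rewrite -(eq_bigr _ (fun B _ => IHn B)) big_split /=; lia.
Qed.

(** The entries of a strict chain determine it, and sorting a totally ordered set recovers the
    chain. *)
Lemma strict_chain_sets P j :
  #|[set A : {set P} | is_chain A & #|A| == j.+1]| = num_chains P j.
Proof.
pose f (t : j.+1.-tuple P) : {set P} := [set x in t].
have f_inj : {in strict_chains P j &, injective f}.
  move=> s t; rewrite !inE => ss st est; apply/val_inj.
  apply: (irr_sorted_eq lt_trans ltxx ss st) => x.
  by move/finset.setP/(_ x): est; rewrite !inE.
rewrite /num_chains -(card_in_imset f_inj); apply: eq_card => A.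
rewrite inE; apply/andP/imsetP => [[/andP[_ cA] /eqP szA]|[t]].
  pose s := sort <=%O (enum A).
  have sz_s : size s == j.+1 by rewrite size_sort -cardE szA.
  exists (Tuple sz_s).
    rewrite inE /= lt_sorted_uniq_le sort_uniq enum_uniq /=.
    apply: (sort_sorted_in (P := mem A)); last by apply/allP => x; rewrite mem_enum.
    move=> x y Ax Ay; exact: (forall_inP (forall_inP cA x Ax)).
  by apply/finset.setP => x; rewrite !inE mem_sort mem_enum.
rewrite inE => st ->.
have ut : uniq t by apply: (sorted_uniq lt_trans ltxx st).
have sz : #|f t| = j.+1 by rewrite cardsE (card_uniqP ut) size_tuple.
split; last by rewrite sz.
rewrite /is_chain -card_gt0 sz /=.
apply/forall_inP => x; rewrite inE => tx; apply/forall_inP => y; rewrite inE => ty.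
have lest : sorted <=%O t by move: st; rewrite lt_sorted_uniq_le => /andP[].
have := @sorted_leq_nth _ _ le_trans le_refl x t lest.
move=> /(_ (index x t) (index y t)); rewrite !inE !index_mem !nth_index //.
have := @sorted_leq_nth _ _ le_trans le_refl x t lest.
move=> /(_ (index y t) (index x t)); rewrite !inE !index_mem !nth_index //.
rewrite /Order.comparable => /(_ ty tx) h1 /(_ tx ty) h2.
by case/orP: (leq_total (index x t) (index y t)) => [/h2 ->|/h1 ->]; rewrite ?orbT.
Qed.

Lemma sum_sd_card P y :
  \sum_(A : Sd P) y ^ #|sd_val A| =
  \sum_(j < #|P|) num_chains P j * y ^ j.+1.
Proof.
rewrite (sum_sd predT (fun A => y ^ #|A|)) /=.
under [RHS]eq_bigr do rewrite -strict_chain_sets -sum1dep_card big_distrl /=.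
rewrite (exchange_big_dep (fun A => is_chain A && true)) /=; last first.
  by move=> j A _ /andP[->].
apply: eq_bigr => A; rewrite andbT => cA.
have gtA : 0 < #|A| by have /andP[] := cA; rewrite -card_gt0.
have szA : #|A|.-1 < #|P| by rewrite prednK // max_card.
rewrite (big_pred1 (Ordinal szA)) ?mul1n /= ?prednK // => j.
by rewrite cA /= -val_eqE /= -[in LHS](prednK gtA) eqSS eq_sym.
Qed.

Lemma multichains_sd P n :
  #|multichains (Sd P) n| + \sum_(j < #|P|) num_chains P j * n ^ j.+1 =
  \sum_(j < #|P|) num_chains P j * n.+1 ^ j.+1.
Proof.
rewrite -!sum_sd_card card_sorted_walks_rev -big_split /=.
by apply: eq_bigr => A _; apply: walks_sd.
Qed.
End Chains.

Local Open Scope ring_scope.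

(** * Surjection numbers and binomial polynomials *)

(* The number of surjections from an m-set onto a j-set. *)
Fixpoint nsurj m j : nat :=
  match m, j with
  | 0%N, 0%N => 1
  | 0%N, _ => 0
  | m.+1, 0%N => 0
  | m.+1, j.+1 => j.+1 * (nsurj m j.+1 + nsurj m j)
  end.

Lemma nsurj_small m j : (m < j)%N -> nsurj m j = 0%N.
Proof.
elim: m j => [|m IHm] [|j] //= ltmj.
by rewrite !IHm ?muln0 // ltnW.
Qed.

Lemma nsurjnn m : nsurj m m = m`!.
Proof. by elim: m => //= m IHm; rewrite nsurj_small ?leqnn // IHm factS. Qed.

Lemma nsurj_1 m : nsurj m.+1 1 = 1%N.
Proof. by elim: m => //= m ->; case: m. Qed.

(** The hypotheses make [b j] behave like the binomial coefficient of [x] over [j]. This serves for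
    natural [x], for [x = -1] with [b j = (-1)^j], and for the polynomial ['X]. *)
Lemma expr_nsurj (R : comNzSemiRingType) (x : R) (b : nat -> R) m :
    b 0%N = 1 -> (forall j, x * b j = j%:R * b j + j.+1%:R * b j.+1) ->
  x ^+ m = \sum_(j < m.+1) (nsurj m j)%:R * b j.
Proof.
move=> b0 bS; elim: m => [|m IHm]; first by rewrite big_ord1 b0 mulr1.
rewrite exprS IHm big_distrr /= [RHS]big_ord_recl /= mul0r add0r.
under eq_bigr do rewrite mulrCA bS mulrDr.
under [RHS]eq_bigr do rewrite natrM natrD mulrDr mulrDl.
rewrite !big_split /=; congr (_ + _).
  rewrite big_ord_recl mul0r mulr0 add0r big_ord_recr /=.
  rewrite nsurj_small // mulr0 mul0r addr0.
  by apply: eq_bigr => j _; rewrite mulrA [_ * (j.+1)%:R]mulrC.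
by apply: eq_bigr => j _; rewrite mulrA [_ * (j.+1)%:R]mulrC.
Qed.

Lemma expn_nsurj n m : (n ^ m = \sum_(j < m.+1) nsurj m j * 'C(n, j))%N.
Proof.
rewrite -[(n ^ m)%N]natn natrX natn.
rewrite (expr_nsurj (b := fun j => 'C(n, j)) m (bin0 n)).
  by apply: eq_bigr => j _; rewrite natn.
move=> j; rewrite !natn; have [|ltjn] := leqP n j.
  rewrite leq_eqVlt => /predU1P[->|lt].
    by rewrite binn bin_small // mulr0 addr0.
  by rewrite !bin_small ?mulr0 // ltnW.
have := mul_bin_left n j.
rewrite -[_ * _]/(muln _ _) -[_ + _]/(addn _ _) -[j.+1 * _]/(muln _ _) -[j * _]/(muln _ _) => ->.
by rewrite -mulnDl subnKC // ltnW.
Qed.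

(** The binomial transform is unitriangular, so its values determine the entries one after the
    other. It lets strict chain numbers be read off from multichain numbers. *)
Lemma sum_bin_inj (a b : nat -> nat) :
  (forall n, \sum_(j < n.+1) 'C(n, j) * a j = \sum_(j < n.+1) 'C(n, j) * b j)%N ->
  a =1 b.
Proof.
move=> eqab j; elim/ltn_ind: j => j IHj.
have := eqab j; rewrite !big_ord_recr /= binn !mul1n.
rewrite (eq_bigr (fun i : 'I_j => 'C(j, i) * b i)%N) => [/addnI//|i _].
by rewrite IHj.
Qed.

Lemma alt_sum_nsurj (R : comNzRingType) m :
  \sum_(j < m.+1) (-1) ^+ j * (nsurj m j)%:R = (-1) ^+ m :> R.
Proof.
rewrite (expr_nsurj (b := fun j => (-1) ^+ j) (x := -1)) //.
  by apply: eq_bigr => j _; rewrite mulrC.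
by move=> j; rewrite -exprS -[j.+1%:R]natr1 exprS; ring.
Qed.

(** * Binomial polynomials and the reflection [X |-> -1 - X] *)

Section Binomial.
Variable F : numFieldType.

(** The binomial polynomial [X (X - 1) ... (X - j + 1) / j!]. *)
Fixpoint binp j : {poly F} :=
  if j is i.+1 then (i.+1%:R)^-1 *: (binp i * ('X - i%:R%:P)) else 1.

Lemma binpS j : binp j.+1 = j.+1%:R^-1 *: (binp j * ('X - j%:R%:P)).
Proof. by []. Qed.
Arguments binp : simpl never.

Lemma mulX_binp j : 'X * binp j = j%:R * binp j + j.+1%:R * binp j.+1.
Proof.
rewrite binpS mulr_natl [_.+1%:R * _]mulr_natl -[_ *+ j.+1]scaler_nat scalerA.
rewrite divff ?pnatr_eq0 // scale1r mulrBr polyC_natr -mulr_natr.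
by rewrite addrC subrK mulrC.
Qed.

Lemma coef_binp_gt j i : (j < i)%N -> (binp j)`_i = 0.
Proof.
elim: j i => [|j IHj] [|i] // lt_ij; first by rewrite coefC.
by rewrite binpS coefZ mulrBr coefB coefMX coefMC /= !IHj ?mul0r ?subr0 ?mulr0 // ltnW.
Qed.

Lemma coef_binp j : (binp j)`_j = (j`!%:R)^-1.
Proof.
elim: j => [|j IHj]; first by rewrite coefC invr1.
rewrite binpS coefZ mulrBr coefB coefMX coefMC /= IHj coef_binp_gt // mul0r subr0.
by rewrite factS natrM invfM.
Qed.

Lemma X_nsurj m : 'X^m = \sum_(j < m.+1) (nsurj m j)%:R *: binp j.
Proof.
rewrite (expr_nsurj (b := binp)) ?mulX_binp //; last exact: mulX_binp.
by apply: eq_bigr => j _; rewrite mulr_natl scaler_nat.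
Qed.

Lemma scale_natM (a m : nat) (p : {poly F}) :
  a%:R *: (m%:R * p) = (m * a)%:R *: p.
Proof. by rewrite mulr_natl -[p *+ m]scaler_nat scalerA -natrM mulnC. Qed.

(** By Vandermonde the sum for [j] is the binomial of [X + j] over [j]; this is the recursion of
    these polynomials, obtained from Pascal's rule and [mulX_binp]. *)
Lemma sum_binp_succ j :
  ('X + j.+1%:R) * (\sum_(l < j.+1) 'C(j, l)%:R *: binp l) =
  j.+1%:R * (\sum_(l < j.+2) 'C(j.+1, l)%:R *: binp l).
Proof.
have pascal : \sum_(l < j.+2) 'C(j.+1, l)%:R *: binp l =
    \sum_(l < j.+1) 'C(j, l)%:R *: binp l + \sum_(l < j.+1) 'C(j, l)%:R *: binp l.+1.
  rewrite big_ord_recl bin0 [X in _ = X + _]big_ord_recl bin0 -addrA; congr (_ + _).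
  under eq_bigr do rewrite binS natrD scalerDl.
  rewrite big_split; congr (_ + _).
  by rewrite big_ord_recr /= bin_small // scale0r addr0.
rewrite pascal !mulrDl mulrDr addrC; congr (_ + _).
rewrite !big_distrr /=.
under eq_bigr do rewrite -scalerAr mulX_binp scalerDr.
rewrite big_split /= big_ord_recl mul0r scaler0 add0r.
have -> : \sum_(i < j) 'C(j, bump 0 i)%:R *: ((bump 0 i)%:R * binp (bump 0 i)) =
          \sum_(i < j.+1) 'C(j, i)%:R *: ((j - i)%:R * binp i.+1).
  rewrite [RHS]big_ord_recr /= subnn mul0r scaler0 addr0; apply: eq_bigr => i _.
  by rewrite !scale_natM /bump /= add1n mul_bin_left.
rewrite -big_split; apply: eq_bigr => i _ /=.
rewrite -scalerDr -mulrDl -natrD -[RHS]scalerAr.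
congr (_ *: (_ * _)).
congr _%:R; by have := ltn_ord i; lia.
Qed.

Lemma sum_binp_succZ j :
  j.+1%:R *: (\sum_(l < j.+2) 'C(j.+1, l)%:R *: binp l) =
  ('X + j.+1%:R) * (\sum_(l < j.+1) 'C(j, l)%:R *: binp l).
Proof. by rewrite sum_binp_succ scaler_nat mulr_natl. Qed.

(** The binomial of [-1 - X] over [j] is [(-1)^j] times that of [X + j] over [j]; both sides satisfy
    the same recursion in [j]. *)
Lemma binp_reflect j :
  binp j \Po (-1 - 'X) = (-1) ^+ j *: \sum_(l < j.+1) 'C(j, l)%:R *: binp l.
Proof.
elim: j => [|j IHj].
  by rewrite big_ord1 /= comp_polyC !scale1r.
rewrite binpS linearZ /= rmorphM /= IHj rmorphB /= comp_polyX comp_polyC polyC_natr.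
apply: (@scalerI _ _ j.+1%:R); first by rewrite pnatr_eq0.
rewrite scalerA divff ?pnatr_eq0 // scale1r -scalerAl exprS mulN1r scaleNr scalerN.
rewrite [X in _ = - X]scalerA [_ * (-1) ^+ j]mulrC -[X in _ = - X]scalerA sum_binp_succZ -scalerN.
by congr (_ *: _); rewrite -natr1; ring.
Qed.

(* The inverse of the action of Sd on the polynomials \sum_j c_j X^(j+1). *)
Definition umbral (p : {poly F}) := \sum_(j < size p) p`_j *: binp j.

Lemma umbralE n (p : {poly F}) : (size p <= n)%N -> umbral p = \sum_(j < n) p`_j *: binp j.
Proof.
move=> le_n; rewrite /umbral (big_ord_widen n (fun j => p`_j *: binp j) le_n) big_mkcond.
apply: eq_bigr => j _; case: ltnP => // /leq_sizeP -> //.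
by rewrite scale0r.
Qed.

Lemma umbral_is_linear : linear umbral.
Proof.
move=> a p q; pose n := maxn (size p) (size q).
rewrite (@umbralE n) ?(@umbralE n p) ?(@umbralE n q) ?leq_maxl ?leq_maxr //.
  rewrite scaler_sumr -big_split; apply: eq_bigr => j _ /=.
  by rewrite coefD coefZ scalerDl scalerA.
rewrite (leq_trans (size_polyD _ _)) // geq_max leq_maxr andbT.
by rewrite (leq_trans (size_scale_leq _ _)) ?leq_maxl.
Qed.
HB.instance Definition _ := GRing.isLinear.Build F {poly F} {poly F} *:%R umbral umbral_is_linear.

Lemma umbralXn j : umbral 'X^j = binp j.
Proof.
rewrite (@umbralE j.+1) ?size_polyXn // (bigD1 ord_max) //= coefXn eqxx scale1r.
by rewrite big1 ?addr0 // => i /negPf ni; rewrite coefXn -[(_ == _ :> nat)]/(i == ord_max) ni scale0r.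
Qed.

(** By linearity only ['X^j] matters, and there [(-1 - X)^j] expands into the right-hand side of
    [binp_reflect] with powers in place of binomial polynomials. *)
Lemma umbral_reflect p : umbral (p \Po (-1 - 'X)) = umbral p \Po (-1 - 'X).
Proof.
rewrite -[p in LHS]coefK poly_def [umbral p]/umbral !raddf_sum.
apply: eq_bigr => j _ /=; rewrite !linearZ /=; congr (_ *: _).
rewrite binp_reflect comp_Xn_poly.
rewrite -opprD -[- (1 + 'X)]scaleN1r exprZn linearZ; congr (_ *: _).
rewrite exprDn linear_sum; apply: eq_bigr => l _ /=.
by rewrite expr1n mul1r -scaler_nat linearZ /= umbralXn.
Qed.

(** [umbral] is triangular with [1 / i!] on the diagonal, so the leading coefficient of a nonzero
    [p] of degree [i] would force [i! = m!] with [i < m]. *)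
Lemma umbral_eigen_small n m (p : {poly F}) :
    (size p <= n)%N -> (n <= m)%N -> (1 < m)%N -> p = m`!%:R *: umbral p -> p = 0.
Proof.
move=> szp lenm m1 eqp; apply/eqP; rewrite -size_poly_eq0; apply/eqP.
case szE: (size p) => [//|i].
have pi : p`_i != 0 by have := lead_coef_eq0 p; rewrite lead_coefE szE /= => ->; rewrite -size_poly_eq0 szE.
have := congr1 (fun p : {poly F} => p`_i) eqp.
rewrite coefZ /umbral coef_sum szE big_ord_recr /= big1 => [|j _]; last first.
  by rewrite coefZ coef_binp_gt ?mulr0.
rewrite add0r coefZ coef_binp mulrCA -{1}[p`_i]mulr1 => /(mulfI pi) /esym/divr1_eq/eqP.
rewrite eqr_nat => /eqP eqf.
have lt_im : (i < m)%N by apply: leq_trans lenm; rewrite -szE.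
(* Degree 0 is compared through [1 < m], as [0! = 1!]. *)
move: eqf; case: i {szE pi szp} lt_im => [|i] lt_im eqf.
  by have := @ltn_fact 1 m isT m1; rewrite eqf.
by have := @ltn_fact i.+1 m isT lt_im; rewrite eqf ltnn.
Qed.
End Binomial.

(** * The zeta series as a rational function *)

Section Hpoly.
Variable F : comNzRingType.

(* The numerator of the zeta series over (1 - X)^(d+1) *)
Definition hpoly d (v : nat -> F) : {poly F} :=
  \sum_(j < d.+1) v j *: ('X^j * (1 - 'X) ^+ (d - j)).

Lemma size_1subX : size (1 - 'X : {poly F}) = 2%N.
Proof. by rewrite -opprB size_polyN size_XsubC. Qed.

Lemma size_exp1subX m : (size ((1 - 'X : {poly F}) ^+ m) <= m.+1)%N.
Proof. by have := size_poly_exp_leq (1 - 'X : {poly F}) m; rewrite size_1subX mul1n. Qed.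

Lemma size_hpoly d v : (size (hpoly d v) <= d.+1)%N.
Proof.
apply: (leq_trans (size_sum _ _ _)); apply/bigmax_leqP => j _.
apply: (leq_trans (size_scale_leq _ _)).
apply: (leq_trans (size_polyMleq _ _)); rewrite size_polyXn addSn /=.
apply: leq_trans (leq_add (leqnn j) (size_exp1subX (d - j))) _.
by rewrite addnS subnKC // -ltnS ltn_ord.
Qed.

Lemma coef_exp1subX m i : ((1 - 'X : {poly F}) ^+ m)`_i = (-1) ^+ i *+ 'C(m, i).
Proof.
elim: m i => [|m IHm] i; first by rewrite coef1; case: i.
rewrite exprS mulrBl mul1r coefB coefXM !IHm; case: i => [|i] /=.
  by rewrite subr0 !bin0.
by rewrite binS mulrnDr [X in _ = _ + X *+ _]exprS mulN1r mulNrn.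
Qed.

Lemma sign_sub m n : (n <= m)%N -> (-1) ^+ (m - n) = (-1) ^+ m * (-1) ^+ n :> F.
Proof. by move=> /subnK {2}<-; rewrite exprD -mulrA -expr2 sqrr_sign mulr1. Qed.

Lemma hpoly_0 d v : (hpoly d v)`_0 = v 0%N.
Proof.
rewrite coef_sum big_ord_recl /= coefZ expr0 mul1r subn0 coef_exp1subX bin0 mulr1.
by rewrite big1 ?addr0 // => j _; rewrite coefZ coefXnM /= mulr0.
Qed.

Lemma hpoly_1 d v : (hpoly d v).[1] = v d.
Proof.
rewrite horner_sum big_ord_recr /= subnn expr0 mulr1 hornerZ hornerXn expr1n mulr1.
rewrite big1 ?add0r // => j _; rewrite hornerZ hornerM horner_exp !hornerE subrr.
by rewrite expr0n subn_eq0 leqNgt ltn_ord /= !mulr0.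
Qed.

Lemma hpoly_d d v : (hpoly d v)`_d = (-1) ^+ d * \sum_(j < d.+1) (-1) ^+ j * v j.
Proof.
rewrite coef_sum big_distrr; apply: eq_bigr => j _ /=.
rewrite coefZ coefXnM ltnNge -ltnS ltn_ord /= coef_exp1subX binn mulr1n mulrC mulrA; congr (_ * _).
by rewrite sign_sub // -ltnS ltn_ord.
Qed.

(** The coefficient next to the top one of [(1 - X)^(d+1-j)] is [d+1-j] up to sign. *)
Lemma hpoly_d1 d v : (hpoly d.+1 v)`_d =
  (-1) ^+ d * \sum_(j < d.+2) (-1) ^+ j * v j * (d.+1 - j)%:R.
Proof.
rewrite coef_sum big_distrr; apply: eq_bigr => j _ /=.
rewrite coefZ coefXnM; have := ltn_ord j; rewrite ltnS leq_eqVlt => /predU1P[->|ltj].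
  by rewrite ltnSn mulr0 subnn !mulr0.
rewrite ltnNge -ltnS ltj /= coef_exp1subX subSn // binSn -[_ *+ _]mulr_natr.
rewrite sign_sub //; set c := _%:R; set e := (-1) ^+ d; set f := (-1) ^+ j; ring.
Qed.

(** Congruence modulo ['X^n], standing for equality of truncated power series. *)
Definition eq_upto n (p q : {poly F}) := forall i, (i < n)%N -> p`_i = q`_i.

Lemma eq_upto_mul n p p' q q' :
  eq_upto n p p' -> eq_upto n q q' -> eq_upto n (p * q) (p' * q').
Proof.
move=> pp qq i ltin; rewrite !coefM; apply: eq_bigr => j _.
by rewrite pp ?qq //; have := ltn_ord j; lia.
Qed.

(** The truncated series of [X^j / (1 - X)^(j+1)]. Multiplying by [1 - X] takes differences of
    [C(i, j+1)], which by Pascal's rule gives [X] times the series for [j]. *)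
Lemma bin_series n j :
  eq_upto n (\poly_(i < n) 'C(i, j)%:R * (1 - 'X) ^+ j.+1) 'X^j.
Proof.
elim: j => [|j IHj].
  move=> i ltin; rewrite expr1 mulrBr mulr1 coefB coefMX coef1 !coef_poly ltin.
  case: i ltin => [|i] ltin; first by rewrite subr0.
  by rewrite !bin0 /= (ltnW ltin) subrr.
have step : eq_upto n (\poly_(i < n) 'C(i, j.+1)%:R * (1 - 'X)) ('X * \poly_(i < n) 'C(i, j)%:R).
  move=> i ltin; rewrite mulrBr mulr1 coefB coefMX coefXM !coef_poly ltin.
  case: i ltin => [|i] ltin /=; first by rewrite subr0.
  by rewrite (ltnW ltin) binS natrD addrC addKr.
move=> i ltin; rewrite exprS mulrA.
rewrite (eq_upto_mul step (fun _ _ => erefl)) // -mulrA [in RHS]exprS.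
by rewrite (eq_upto_mul (fun _ _ => erefl) IHj).
Qed.

Lemma hpoly_series n d (v a : nat -> F) :
  (forall i, a i = \sum_(j < d.+1) 'C(i, j)%:R * v j) ->
  eq_upto n (\poly_(i < n) a i * (1 - 'X) ^+ d.+1) (hpoly d v).
Proof.
move=> aE i ltin.
have -> : \poly_(i < n) a i = \sum_(j < d.+1) v j *: \poly_(i < n) 'C(i, j)%:R.
  apply/polyP => m; rewrite coef_poly coef_sum.
  case: ifP => ltmn; last by rewrite big1 // => j _; rewrite coefZ coef_poly ltmn mulr0.
  by rewrite aE; apply: eq_bigr => j _; rewrite coefZ coef_poly ltmn mulrC.
rewrite big_distrl !coef_sum; apply: eq_bigr => j _ /=.
rewrite -scalerAl !coefZ; congr (_ * _).
have dE : d.+1 = (j.+1 + (d - j))%N by have := ltn_ord j; lia.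
by rewrite [X in _ ^+ X]dE exprD mulrA (eq_upto_mul (@bin_series n j) (fun _ _ => erefl)).
Qed.
End Hpoly.

Lemma map_hpoly (F G : comNzRingType) (f : {rmorphism F -> G}) d v :
  map_poly f (hpoly d v) = hpoly d (f \o v).
Proof.
rewrite rmorph_sum; apply: eq_bigr => j _ /=.
by rewrite map_polyZ rmorphM /= map_polyXn rmorphXn rmorphB /= rmorph1 map_polyX.
Qed.

Section Zeta.
Variable F : fieldType.

(** A rational function is determined by its expansion: after cross-multiplication two
    representations agree modulo every power of [X]. *)
Lemma has_expansion_hpoly d (v a : nat -> F) Z :
  (forall i, a i = \sum_(j < d.+1) 'C(i, j)%:R * v j) ->
  has_expansion Z a <->
  Z = tofrac (hpoly d v) / tofrac ((1 - 'X) ^+ d.+1).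
Proof.
move=> aE.
have D0 : ((1 - 'X : {poly F}) ^+ d.+1)`_0 != 0.
  by rewrite coef_exp1subX bin0 oner_neq0.
have nz (q : {poly F}) : q`_0 != 0 -> tofrac q != 0 :> {fraction {poly F}}.
  by move=> q0; rewrite tofrac_eq0; apply: contraNneq q0 => ->; rewrite coef0.
have conv (q : {poly F}) n : \sum_(i < n.+1) a i * q`_(n - i) = (\poly_(i < n.+1) a i * q)`_n.
  by rewrite coefM; apply: eq_bigr => i _; rewrite coef_poly ltn_ord.
split=> [[p [q [q0 -> pE]]]|->]; last first.
  exists (hpoly d v), ((1 - 'X) ^+ d.+1); split=> // n.
  by rewrite conv (hpoly_series aE).
apply/eqP; rewrite eqr_div ?nz // -!tofracM tofrac_eq; apply/eqP/polyP => n.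
have pU : eq_upto n.+1 p (\poly_(i < n.+1) a i * q).
  move=> i lti; rewrite pE conv; apply: (eq_upto_mul (n := i.+1)) => // j ltj.
  by rewrite !coef_poly ltj (leq_trans ltj).
rewrite (eq_upto_mul (n := n.+1) pU (fun _ _ => erefl)) //.
by rewrite mulrAC (eq_upto_mul (hpoly_series aE) (fun _ _ => erefl)).
Qed.

(** Two representations in lowest terms have associated numerators, and the present one is in lowest
    terms because [hpoly] takes the value [v d] at 1. *)
Lemma zeros_of_hpoly d (v : nat -> F) s : v d != 0 ->
  zeros_of (tofrac (hpoly d v) / tofrac ((1 - 'X) ^+ d.+1)) s <->
  hpoly d v %= \prod_(z <- s) ('X - z%:P).
Proof.
move=> vd0; set h := hpoly d v; set D := (1 - 'X : {poly F}) ^+ d.+1.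
have D0 : D != 0 by rewrite expf_neq0 // -size_poly_eq0 size_1subX.
have cop : coprimep h D.
  apply: coprimep_expr; rewrite -opprB -[- _]scaleN1r coprimepZr ?oppr_eq0 ?oner_eq0 //.
  by rewrite coprimep_XsubC rootE hpoly_1.
split=> [[p [q [q0 copq eqZ pE]]]|hE]; last by exists h, D.
apply: eqp_trans pE; move/eqP: eqZ; rewrite eqr_div ?tofrac_eq0 //.
rewrite -!tofracM tofrac_eq => /eqP eqZ.
rewrite /eqp -(Gauss_dvdpl _ cop) -eqZ dvdp_mulr //=.
by rewrite -(Gauss_dvdpl _ copq) eqZ dvdp_mulr.
Qed.
End Zeta.

Local Open Scope nat_scope.

(** * Chains of the barycentric subdivision *)

Section BigTrunc.
Variables (T : Type) (idx : T) (op : Monoid.com_law idx).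

Lemma big_ord_trunc m n (F : nat -> T) :
    (forall j, (m <= j) || (n <= j) -> F j = idx) ->
  \big[op/idx]_(j < m) F j = \big[op/idx]_(j < n) F j.
Proof.
have extend i k : i <= k -> (forall j, i <= j -> F j = idx) ->
    \big[op/idx]_(j < k) F j = \big[op/idx]_(j < i) F j.
  move=> leik F0; rewrite (big_ord_widen k F leik) [RHS]big_mkcond.
  by apply: eq_bigr => j _; case: ltnP => // /F0.
move=> F0; have [le|/ltnW le] := leqP m n.
  by rewrite (extend m) // => j mj; rewrite F0 ?mj.
by rewrite (extend n) // => j mj; rewrite F0 ?mj ?orbT.
Qed.
End BigTrunc.

(** Taking the difference in [n] of [n^m = \sum_j C(n, j) nsurj m j] turns [C(n, j+1)] into
    [C(n, j)], hence the shifted index. *)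
Lemma expn_succ_nsurj n m :
  n.+1 ^ m = n ^ m + \sum_(j < n.+1) 'C(n, j) * nsurj m j.+1.
Proof.
have trunc k : k ^ m = \sum_(j < k.+1) 'C(k, j) * nsurj m j.
  rewrite expn_nsurj (@big_ord_trunc _ _ _ (m.+1) (k.+1) (fun j => nsurj m j * 'C(k, j))).
    by apply: eq_bigr => j _; rewrite mulnC.
  by move=> j /orP[/nsurj_small->|/bin_small->]; rewrite ?muln0.
by rewrite [LHS]trunc (sum_bin_succ n (nsurj m)) -trunc.
Qed.

Section ChainsSd.
Context {disp : Order.disp_t}.
Implicit Type P : finPOrderType disp.

(** Both sides have the same binomial transform, the multichain numbers of [Sd P], which
    [multichains_sd] expresses through differences of powers. *)
Lemma num_chains_sd_card P j :
  num_chains (Sd P) j = \sum_(i < #|P|) num_chains P i * nsurj i.+1 j.+1.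
Proof.
move: j; apply: sum_bin_inj => n; rewrite -card_multichains.
apply: (@addIn (\sum_(i < #|P|) num_chains P i * n ^ i.+1)).
rewrite multichains_sd.
under eq_bigr do rewrite expn_succ_nsurj mulnDr.
rewrite big_split addnC /=; congr (_ + _).
under eq_bigr do rewrite big_distrr /=.
rewrite exchange_big; apply: eq_bigr => j _.
by rewrite big_distrr; apply: eq_bigr => i _; rewrite mulnCA.
Qed.

Lemma num_chains_card P j : #|P| <= j -> num_chains P j = 0.
Proof.
move=> lePj; apply/eqP; rewrite cards_eq0; apply/eqP/finset.setP => t; rewrite !inE.
apply/negbTE/negP => /(sorted_uniq lt_trans ltxx) /card_uniqP.
have := max_card (mem t); rewrite size_tuple => + tE; rewrite tE.
by rewrite leqNgt ltnS lePj.
Qed.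

Lemma num_chains_gt_dim P j : poset_dim P < j -> num_chains P j = 0.
Proof.
have [/num_chains_card //|ltjP] := leqP #|P| j; apply: contraTeq => cj.
rewrite -leqNgt.
by apply: (@leq_bigmax_cond _ _ (fun i : 'I_#|P| => i : nat) (Ordinal ltjP)); rewrite -card_gt0 lt0n.
Qed.

Lemma num_chains_dim P : 0 < poset_dim P -> 0 < num_chains P (poset_dim P).
Proof.
move=> d0; pose A := [pred i : 'I_#|P| | strict_chains P i != finset.set0].
have [A0|A0] := posnP #|A|.
  by move: d0; rewrite /poset_dim big_pred0 // => i; have := card0_eq A0 i; rewrite inE.
have [i Ai] := eq_bigmax_cond (fun i : 'I_#|P| => i : nat) A0.
rewrite /poset_dim => ->; rewrite /num_chains card_gt0; exact: Ai.
Qed.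

Lemma num_chains_0 P j : 0 < num_chains P j -> 0 < num_chains P 0.
Proof.
move=> /card_gt0P [t _]; rewrite /num_chains card_sorted_walks /= sum1_card.
by apply/card_gt0P; exists (thead t).
Qed.

Lemma num_chains_sd P d j : (forall i, d < i -> num_chains P i = 0) ->
  num_chains (Sd P) j = \sum_(i < d.+1) num_chains P i * nsurj i.+1 j.+1.
Proof.
move=> c0; rewrite num_chains_sd_card.
apply: (@big_ord_trunc _ _ _ _ _ ( fun i => num_chains P i * nsurj i.+1 j.+1)) => i.
by case/orP=> [/num_chains_card->|/c0->].
Qed.

Lemma num_chains_sd_gt P d j : (forall i, d < i -> num_chains P i = 0) -> d < j ->
  num_chains (Sd P) j = 0.
Proof.
move=> c0 ltdj; rewrite (num_chains_sd _ c0) big1 // => i _.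
by rewrite nsurj_small ?muln0 // ltnS (leq_trans (ltn_ord i)).
Qed.

Lemma num_chains_iter_gt P d k j : poset_dim P = d -> d < j ->
  num_chains (iter_Sd k P) j = 0.
Proof.
move=> dimP; elim: k j => [|k IHk] j ltdj; first by rewrite num_chains_gt_dim ?dimP.
exact: (num_chains_sd_gt IHk).
Qed.

Lemma num_chains_iterS P d k j : poset_dim P = d ->
  num_chains (iter_Sd k.+1 P) j =
  \sum_(i < d.+1) num_chains (iter_Sd k P) i * nsurj i.+1 j.+1.
Proof. by move=> dimP; apply: num_chains_sd => i; exact: num_chains_iter_gt. Qed.

(** Only the diagonal entry [(d+1)!] of the triangular subdivision matrix contributes at index
    [d]. *)
Lemma num_chains_iter_top P d k : poset_dim P = d ->
  num_chains (iter_Sd k P) d = d.+1`! ^ k * num_chains P d.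
Proof.
move=> dimP; elim: k => [|k IHk]; first by rewrite mul1n.
rewrite (num_chains_iterS _ _ dimP) big_ord_recr [nat_of_ord _]/= nsurjnn IHk.
rewrite big1 ?add0n => [|i _]; first by rewrite mulnC mulnA -expnS.
have lt_i : i.+1 < d.+1 := ltn_ord i.
by rewrite (nsurj_small lt_i) muln0.
Qed.

(** Row [i] of the subdivision matrix has alternating sum [(-1)^i]: this is [alt_sum_nsurj] with
    both indices shifted by one, which costs one sign on each side. *)
Lemma euler_iter P d k : poset_dim P = d ->
  (\sum_(j < d.+1) (-1) ^+ j * (num_chains (iter_Sd k P) j)%:Z = euler_char P)%R.
Proof.
move=> dimP; elim: k => [|k <-]; first by rewrite /euler_char dimP.
under eq_bigr do rewrite (num_chains_iterS _ _ dimP) -natz natr_sum big_distrr /=.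
rewrite exchange_big; apply: eq_bigr => i _ /=.
under eq_bigr do rewrite natrM mulrCA.
rewrite -big_distrr /= mulrC natz; congr (_ * _)%R.
have := @alt_sum_nsurj int i.+1.
rewrite big_ord_recl /= mulr0 add0r exprS mulN1r => e; apply: oppr_inj; rewrite -e -sumrN.
rewrite (@big_ord_trunc _ _ _ (d.+1) (i.+1) (fun j => - ((-1) ^+ j * (nsurj i.+1 j.+1)%:R))%R).
  by apply: eq_bigr => j _; rewrite exprS mulN1r mulNr.
move=> j /orP ltj; rewrite (_ : nsurj _ _ = 0) ?mulr0 ?oppr0 //.
by apply: nsurj_small; have := ltn_ord i; lia.
Qed.

Lemma zeta_zerosP (F : fieldType) P d s :
    (forall i, d < i -> num_chains P i = 0) ->
    ((num_chains P d)%:R != 0 :> F)%R ->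
  zeta_zeros P s <->
  (hpoly d (fun j => (num_chains P j)%:R : F) %= \prod_(z <- s) ('X - z%:P))%R.
Proof.
move=> c0 cd.
have aE i : (#|multichains P i|%:R = \sum_(j < d.+1) 'C(i, j)%:R * (num_chains P j)%:R :> F)%R.
  rewrite card_multichains natr_sum.
  rewrite (@big_ord_trunc _ _ _ (d.+1) (i.+1) (fun j => 'C(i, j)%:R * (num_chains P j)%:R : F)%R).
    by apply: eq_bigr => j _; rewrite natrM.
  by move=> j /orP[/c0->|/bin_small->]; rewrite ?mulr0 ?mul0r.
have zE Z := @has_expansion_hpoly F d (fun j => (num_chains P j)%:R%R) (fun i => #|multichains P i|%:R%R) Z aE.
split=> [[Z /zE ->]|hs]; first by rewrite zeros_of_hpoly.
by eexists; [exact/zE | exact/zeros_of_hpoly].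
Qed.
End ChainsSd.

Local Open Scope ring_scope.
Local Open Scope classical_set_scope.

(** * Convergence of roots *)

Section RootAsymptotics.
Variable C : numClosedFieldType.

Lemma cvg_sum_fun (I : Type) (r : seq I) (u : I -> nat -> C) (l : I -> C) :
    (forall i, u i k @[k --> \oo] --> l i) ->
  (\sum_(i <- r) u i k) @[k --> \oo] --> \sum_(i <- r) l i.
Proof.
move=> ul; apply: cvg_big => [|i _]; last exact: ul.
exact: add_continuous.
Qed.

Lemma cvg_inv (u : nat -> C) (l : C) :
  l != 0 -> u k @[k --> \oo] --> l -> (u k)^-1 @[k --> \oo] --> l^-1.
Proof. by move=> l0 ul; exact: cvgV. Qed.

Lemma cvg0_of_exp_le (u v : nat -> C) n : (0 < n)%N ->
    (forall k, `|u k| ^+ n <= `|v k|) ->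
  v k @[k --> \oo] --> 0 -> u k @[k --> \oo] --> 0.
Proof.
move=> n0 uv /cvgr0Pnorm_lt v0; apply/cvgr0Pnorm_lt => e e0.
have en0 : 0 < e ^+ n by rewrite exprn_gt0.
have := v0 _ en0; apply: filterS => k vk.
by rewrite -(ltr_pXn2r n0) ?nnegrE ?normr_ge0 ?ltW // (le_lt_trans (uv k)).
Qed.

(** The order on [C] is only partial, hence the reality hypothesis. *)
Lemma seq_min (T : eqType) (f : T -> C) (s : seq T) :
    (forall x, f x \is Num.real) -> s != [::] ->
  exists2 x, x \in s & forall y, y \in s -> f x <= f y.
Proof.
move=> fr; elim: s => // a [|b s] IHs _.
  by exists a; rewrite ?mem_head // => y; rewrite inE => /eqP ->.
have [//|x xs xmin] := IHs.
have /orP[ax|xa] := real_leVge (fr a) (fr x).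
  exists a; rewrite ?mem_head // => y; rewrite inE => /predU1P[->//|ys].
  exact: le_trans ax (xmin y ys).
exists x; first by rewrite inE xs orbT.
move=> y; rewrite inE => /predU1P[->//|].
exact: xmin.
Qed.

Definition cvg_coef (p : nat -> {poly C}) (q : {poly C}) :=
  forall j, (p k)`_j @[k --> \oo] --> q`_j.

Lemma cvg_horner (p : nat -> {poly C}) (q : {poly C}) n x : (forall k, size (p k) <= n)%N -> (size q <= n)%N ->
  cvg_coef p q -> (p k).[x] @[k --> \oo] --> q.[x].
Proof.
move=> szp szq pq; rewrite (horner_coef_wide _ szq).
under eq_fun do rewrite (horner_coef_wide _ (szp _)).
apply: (cvg_sum_fun (u := fun (i : 'I_n) k => (p k)`_i * x ^+ i) (l := fun i => q`_i * x ^+ i)) => i.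
by apply: cvgM; [exact: pq|exact: cvg_cst].
Qed.

(** The quotient is recovered from the top down by [q_j = (('X - b) q)_(j+1) + b q_(j+1)]; the
    common degree bound [n] starts the descent. *)
Lemma cvg_coef_divX (p : nat -> {poly C}) (q : {poly C}) (a : nat -> C) (b : C) n :
    (forall k, size (p k) <= n)%N -> (size q <= n)%N ->
    a k @[k --> \oo] --> b ->
    cvg_coef (fun k => ('X - (a k)%:P) * p k) (('X - b%:P) * q) ->
  cvg_coef p q.
Proof.
move=> szp szq ab pq j.
have [m] : {m | n <= j + m}%N by exists n; rewrite leq_addl.
elim: m j => [|m IHm] j lenj.
  rewrite addn0 in lenj.
  rewrite nth_default ?(leq_trans szq) //.
  under eq_fun do rewrite nth_default ?(leq_trans (szp _)) //.
  exact: cvg_cst.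
have rec (r : {poly C}) c : r`_j = (('X - c%:P) * r)`_j.+1 + c * r`_j.+1.
  by rewrite mulrBl coefB coefXM coefCM subrK.
rewrite (rec q b); under eq_fun => k do rewrite (rec (p k) (a k)).
apply: cvgD; first exact: pq.
by apply: cvgM => //; apply: IHm; rewrite addSnnS.
Qed.

(** The divisor has constant term 1, so the coefficients of the quotient are recovered from the
    bottom up. *)
Lemma cvg_coef_div1 (p : nat -> {poly C}) (q : {poly C}) (a : nat -> C) :
    a k @[k --> \oo] --> 0 ->
    cvg_coef (fun k => (1 - a k *: 'X) * p k) q ->
  cvg_coef p q.
Proof.
move=> a0 pq; elim=> [|j IHj].
  have := pq 0%N; under eq_fun do rewrite mulrBl mul1r -scalerAl coefB coefZ coefXM mulr0 subr0.
  by [].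
have rec (r : {poly C}) c : r`_j.+1 = ((1 - c *: 'X) * r)`_j.+1 + c * r`_j.
  by rewrite mulrBl mul1r -scalerAl coefB coefZ coefXM subrK.
under eq_fun => k do rewrite (rec (p k) (a k)).
have -> : q`_j.+1 = q`_j.+1 + 0 * q`_j by rewrite mul0r addr0.
by apply: cvgD; [exact: pq|exact: cvgM].
Qed.

Lemma norm_prod_min z (s : seq C) :  s != [::] ->
  exists2 x, x \in s &
    `|x - z| ^+ size s <= `|(\prod_(y <- s) ('X - y%:P)).[z]|.
Proof.
move=> s0; have [|x xs xmin] := @seq_min _ (fun y => `|y - z|) s _ s0.
  by move=> y; exact: normr_real.
exists x => //; rewrite horner_prod normr_prod.
elim: s {s0 xs} xmin => [|y s IHs] xmin; first by rewrite big_nil.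
rewrite big_cons exprS ler_pM ?exprn_ge0 //.
  by rewrite hornerXsubC [`|z - y|]distrC xmin ?mem_head.
by apply: IHs => w ws; rewrite xmin // inE ws orbT.
Qed.

(** If [x k] is the root nearest to [z0], a power of [|x k - z0|] is at most the modulus of the
    [k]-th polynomial at [z0], which tends to 0. Dividing out these roots leaves the same situation
    with one root less. *)
Lemma roots_cvg n (z : seq C) (b : nat -> seq C) :
    size z = n -> (forall k, size (b k) = n) ->
    cvg_coef (fun k => \prod_(x <- b k) ('X - x%:P)) (\prod_(x <- z) ('X - x%:P)) ->
  exists2 g : nat -> seq C, (forall k, perm_eq (g k) (b k)) &
    forall i, (i < n)%N -> (g k)`_i @[k --> \oo] --> z`_i.
Proof.
elim: n z b => [|n IHn] [|z0 z] b //= szz szb bz.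
  by exists b => // k.
case: szz => szz.
have b0 k : b k != [::] by rewrite -size_eq0 szb.
pose x k := projT1 (cid2 (norm_prod_min z0 (b0 k))).
have xP k : x k \in b k by rewrite /x; case: cid2.
have xle k : `|x k - z0| ^+ n.+1 <= `|(\prod_(y <- b k) ('X - y%:P)).[z0]|.
  by rewrite -[n.+1](szb k) /x; case: cid2.
have xz : x k @[k --> \oo] --> z0.
  apply/subr_cvg0; apply: (cvg0_of_exp_le (ltn0Sn n) xle).
  have -> : 0 = (\prod_(y <- z0 :: z) ('X - y%:P)).[z0].
    by rewrite big_cons hornerM hornerXsubC subrr mul0r.
  apply: (@cvg_horner _ _ n.+2) => // [k|]; by rewrite size_prod_XsubC /= ?szb ?szz.
have [k|k|g gb gz] := IHn z (fun k => rem (x k) (b k)) szz.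
- by rewrite size_rem ?szb.
- apply: (@cvg_coef_divX _ _ x z0 n.+1) => // [j||j].
  + by rewrite size_prod_XsubC size_rem ?szb.
  + by rewrite size_prod_XsubC szz.
  + have := bz j; rewrite big_cons.
    by under eq_fun do rewrite (perm_big _ (perm_to_rem (xP _))) big_cons.
exists (fun k => x k :: g k) => [k|[|i] lti] /=; last exact: gz.
  by rewrite perm_sym (perm_trans (perm_to_rem (xP k))) // perm_cons perm_sym.
exact: xz.
Qed.

(* As H has degree only d - 1, one root of h k escapes to infinity. Dividing
   h k by 1 - X / b k 1 leaves polynomials whose degree is constantly d - 1. *)
Lemma roots_degree_drop d (h : nat -> {poly C}) (H : {poly C})
    (b : nat -> nat -> C) :
    (0 < d)%N -> cvg_coef h H ->
    (forall k, h k %= \prod_(i <- index_iota 1 d.+1) ('X - (b k i)%:P)) ->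
    (forall k i, (1 <= i <= d)%N -> `|b k i| <= `|b k 1%N|) ->
    (forall k, (h k)`_0 != 0) ->
    H`_0 != 0 -> (size H = d) ->
  [/\ `|b k 1%N| @[k --> \oo] --> +oo,
      exists g : nat -> nat -> C,
        [/\ forall k, perm_eq [seq g k i | i <- index_iota 2 d.+1]
                               [seq b k i | i <- index_iota 2 d.+1],
            forall i, (2 <= i <= d)%N -> cvg (g k i @[k --> \oo]) &
            \forall k \near \oo, forall i, (2 <= i <= d)%N ->
               `|b k i| < `|b k 1%N| ]
    & \prod_(2 <= i < d.+1) b k i @[k --> \oo]
       --> (-1) ^+ d.-1 * (H`_0 / H`_d.-1) ].
Proof.
move=> d0 hH hE bmax h0 H0 szH.
pose Q k : {poly C} := \prod_(i <- index_iota 2 d.+1) ('X - (b k i)%:P).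
pose l k := (h k)`_d.
have szprod m k : size (\prod_(i <- index_iota m d.+1) ('X - (b k i)%:P)) = (d.+1 - m).+1.
  by rewrite -(big_map (b k) xpredT (fun x => 'X - x%:P)) size_prod_XsubC size_map size_iota.
have hE1 k : h k = l k *: (('X - (b k 1%N)%:P) * Q k).
  have /eqpP [[c1 c2] /= /andP[c10 c20] e] := hE k.
  have e1 : h k = (c1^-1 * c2) *: \prod_(i <- index_iota 1 d.+1) ('X - (b k i)%:P).
    by rewrite -scalerA -e scalerA mulVf // scale1r.
  have lE : l k = c1^-1 * c2.
    rewrite /l e1 coefZ.
    rewrite -[X in _`_X](_ : (size (\prod_(i <- index_iota 1 d.+1) ('X - (b k i)%:P))).-1 = d);
      last by rewrite szprod subn1.
    rewrite -lead_coefE -(big_map (b k) xpredT (fun x => 'X - x%:P)).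
    by rewrite (monicP (monic_prod_XsubC _ _ _)) mulr1.
  by rewrite {1}e1 lE -big_ltn.
have l0 : l k @[k --> \oo] --> 0.
  by have := hH d; rewrite nth_default // szH.
have b10 k : b k 1%N != 0.
  by apply: contraNneq (h0 k) => b0; rewrite hE1 b0 subr0 coefZ coefXM mulr0.
have lk0 k : l k != 0.
  by apply: contraNneq (h0 k) => l0k; rewrite hE1 l0k scale0r coef0.
pose t k := (b k 1%N)^-1.
have t0 : t k @[k --> \oo] --> 0.
  (* No root exceeds [b k 1] in modulus, so [|h k (0)| <= |l k| |b k 1|^d]; hence
     [|t k|^d <= |l k / h k (0)|], which tends to 0. *)
  apply: (@cvg0_of_exp_le _ (fun k => l k * ((h k)`_0)^-1) d) => // [k|]; last first.
    rewrite -[X in _ --> X](mul0r (H`_0)^-1); apply: cvgM => //; apply: cvg_inv => //; exact: (hH 0%N).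
  have h0E : (h k)`_0 = l k * \prod_(1 <= i < d.+1) (- b k i).
    rewrite hE1 /Q -(@big_ltn _ _ _ 1 d.+1) // coefZ -horner_coef0 horner_prod.
    by congr (_ * _); apply: eq_bigr => i _; rewrite hornerXsubC sub0r.
  have prod_le : \prod_(1 <= i < d.+1) `|- b k i| <= `|b k 1%N| ^+ d.
    rewrite -[X in _ ^+ X](subn1 d.+1) -prodr_const_nat !big_seq.
    apply: ler_prod => i; rewrite mem_index_iota => ri.
    by rewrite normr_ge0 normrN bmax.
  have prod_gt0 : 0 < \prod_(1 <= i < d.+1) `|- b k i|.
    rewrite -normr_prod normr_gt0.
    by apply: contraNneq (h0 k); rewrite h0E => ->; rewrite mulr0.
  rewrite h0E invfM mulrA divff // mul1r.
  rewrite [X in _ <= X]normfV normr_prod.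
  by rewrite /t normfV exprVn lef_pV2 ?posrE ?exprn_gt0 ?normr_gt0.
have b1oo (M : C) : 0 < M -> \forall k \near \oo, M < `|b k 1%N|.
  move=> M0; have Mi0 : 0 < M^-1 by rewrite invr_gt0.
  have /cvgr0Pnorm_lt/(_ _ Mi0) := t0.
  apply: filterS => k; rewrite normfV ltf_pV2 ?posrE ?normr_gt0 //.
pose G k := (- l k * b k 1%N) *: Q k.
have GH : cvg_coef G H.
  apply: (cvg_coef_div1 t0) => j; have := hH j.
  under eq_fun do rewrite hE1.
  suff hG k : l k *: (('X - (b k 1%N)%:P) * Q k) = (1 - t k *: 'X) * G k.
    by under eq_fun do rewrite hG.
  have tb : (t k)%:P * (b k 1%N)%:P = 1 :> {poly C} by rewrite -polyCM mulVf.
  have -> : 'X - (b k 1%N)%:P = (t k)%:P * (b k 1%N)%:P * 'X - (b k 1%N)%:P.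
    by rewrite tb mul1r.
  rewrite /G -!mul_polyC !rmorphM rmorphN /=; ring.
have szQ k : size (Q k) = d by rewrite szprod; lia.
have mE k : (G k)`_d.-1 = - l k * b k 1%N.
  have : lead_coef (Q k) = 1.
    rewrite /Q -(big_map (b k) xpredT (fun x => 'X - x%:P)).
    by apply/monicP/monic_prod_XsubC.
  by rewrite lead_coefE szQ coefZ => ->; rewrite mulr1.
have m0 k : (G k)`_d.-1 != 0 by rewrite mE mulf_neq0 ?oppr_eq0.
have lH0 : H`_d.-1 != 0.
  by rewrite -szH -lead_coefE lead_coef_eq0 -size_poly_eq0 szH -lt0n.
(* [Q k] is [G k] made monic, and the leading coefficient of [G k] tends to the nonzero one of
   [H]. *)
have QH : cvg_coef Q ((H`_d.-1)^-1 *: H).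
  move=> j; rewrite coefZ.
  have QE k : (Q k)`_j = ((G k)`_d.-1)^-1 * (G k)`_j.
    by rewrite mE /G coefZ mulKf // -mE.
  under eq_fun do rewrite QE.
  apply: cvgM; last exact: GH.
  by apply: cvg_inv => //; exact: GH.
have [z zE] := closed_field_poly_normal ((H`_d.-1)^-1 *: H).
have lc1 : lead_coef ((H`_d.-1)^-1 *: H) = 1.
  by rewrite lead_coefZ lead_coefE szH mulVf.
rewrite lc1 scale1r in zE.
have szz : size z = d.-1.
  have := congr1 (fun p : {poly C} => size p) zE.
  by rewrite size_prod_XsubC size_scale ?invr_eq0 // szH => ->.
have [|||g gb gz] := @roots_cvg d.-1 z (fun k => [seq b k i | i <- index_iota 2 d.+1]).
- by [].
- by move=> k; rewrite size_map size_iota; lia.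
- by rewrite -zE => j; under eq_fun do rewrite big_map; exact: QH.
have szg k : size (g k) = d.-1.
  by rewrite (perm_size (gb k)) size_map size_iota; lia.
(* Positions in [g k] start at 0, while the labels of the bounded roots start at 2. *)
have gammaE k : [seq (g k)`_(i - 2) | i <- index_iota 2 d.+1] = g k.
  rewrite /index_iota -[X in iota X _](addn0 2%N) iotaDl -map_comp -[RHS](mkseq_nth 0) szg /mkseq.
  rewrite (_ : d.+1 - 2 = d.-1)%N; last lia.
  by apply: eq_map => i /=; rewrite addKn.
split.
- apply/cvgryPgtr => A Ar.
  have : 0 < `|A| + 1 by rewrite ltr_wpDl.
  move=> /b1oo; apply: filterS => k; apply: le_lt_trans.
  by rewrite (le_trans (real_ler_norm Ar)) // lerDl.
- exists (fun k i => (g k)`_(i - 2)); split.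
  + by move=> k; rewrite gammaE.
  + move=> i ri; apply/cvg_ex; exists (z`_(i - 2)); apply: gz; lia.
  (* [M] exceeds the modulus of every limit by at least 1, so it eventually bounds all roots listed
     in [g k]. *)
  pose M : C := 1 + \sum_(x <- z) `|x|.
  have M0 : 0 < M by rewrite ltr_pwDl // sumr_ge0.
  have gM : \forall k \near \oo, forall i : 'I_d.-1, `|(g k)`_i| < M.
    apply: filter_forall => i.
    have gzi := gz i (ltn_ord i).
    have /cvgrPdist_lt/(_ 1 ltr01) := gzi; apply: filterS => k /= lt1.
    rewrite -[(g k)`_i](subrK z`_i) (le_lt_trans (ler_normD _ _)) // distrC.
    rewrite /M ltr_leD // (big_nth 0) big_mkord szz (bigD1 i) //= lerDl.
    by rewrite sumr_ge0.
  have := b1oo _ M0; apply: filterS2 gM => k gM bM i ri; apply: lt_trans bM.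
  have : b k i \in g k.
    rewrite (perm_mem (gb k)); apply/mapP; exists i => //.
    by rewrite mem_index_iota.
  by move=> /(nthP 0) [j ltj <-]; rewrite szg in ltj; exact: (gM (Ordinal ltj)).
have QE k : (Q k)`_0 = (-1) ^+ d.-1 * \prod_(2 <= i < d.+1) b k i.
  rewrite -horner_coef0 horner_prod.
  under eq_bigr do rewrite hornerXsubC sub0r -mulN1r.
  by rewrite big_split /= prodr_const_nat subSS subn1.
have prodE k : \prod_(2 <= i < d.+1) b k i = (-1) ^+ d.-1 * (Q k)`_0.
  by rewrite QE mulrA -expr2 sqrr_sign mul1r.
under eq_fun do rewrite prodE.
apply: cvgM; first exact: cvg_cst.
by have := QH 0%N; rewrite coefZ mulrC.
Qed.
End RootAsymptotics.

(** * The limit of the normalised chain numbers *)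

Section Symmetry.
Variable F : numFieldType.

(** The difference [r] of the two sides is again an eigenvector, since [umbral] commutes with the
    reflection, and the leading terms cancel in it; [umbral_eigen_small] then makes it zero. *)
Lemma umbral_eigen_reflect n (q : {poly F}) :
    size q = n.+1 -> (1 < n)%N -> q = n`!%:R *: umbral q ->
  q = (-1) ^+ n *: (q \Po (-1 - 'X)).
Proof.
move=> szq n1 qE; apply/eqP; rewrite -subr_eq0; set r := _ - _.
have XE : -1 - 'X = - ('X - (-1)%:P) :> {poly F} by rewrite polyCN opprK opprD addrC.
have szX : size (-1 - 'X : {poly F}) = 2%N by rewrite XE size_polyN size_XsubC.
have lcX : lead_coef (-1 - 'X : {poly F}) = -1 by rewrite XE lead_coefN lead_coefXsubC.
have szc : size (q \Po (-1 - 'X)) = n.+1 by rewrite size_comp_poly2.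
apply/eqP/(@umbral_eigen_small _ n n) => //.
- apply/leq_sizeP => j; rewrite leq_eqVlt => /predU1P[<-|ltnj].
    have sz1 : (1 < size (-1 - 'X : {poly F})%R)%N by rewrite szX.
    have := lead_coef_comp q sz1; rewrite lcX !lead_coefE szc szq /= => e.
    by rewrite coefB coefZ e mulrCA -expr2 sqrr_sign mulr1 subrr.
  apply: nth_default; rewrite (leq_trans _ ltnj) //.
  rewrite (leq_trans (size_polyD _ _)) // geq_max szq leqnn size_polyN.
  by rewrite (leq_trans (size_scale_leq _ _)) // szc.
- rewrite /r [umbral (_ - _)]linearB /= [umbral (_ *: _)]linearZ /= umbral_reflect.
  rewrite scalerBr; congr (_ - _); first exact: qE.
  rewrite [RHS]scalerA mulrC -scalerA; congr (_ *: _).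
  by rewrite {1}qE comp_polyZ.
Qed.

(* The zeros of hpoly correspond to those of q = \sum_j v j X^(j+1) by
   s = t / (1 + t), which turns t |-> -1 - t into s |-> 1 / s; so hpoly is
   palindromic of degree d - 1. *)
Lemma hpoly_eigen d (v : nat -> F) : (0 < d)%N -> v d != 0 -> v 0%N != 0 ->
    (forall j, (j <= d)%N -> d.+1`!%:R * v j = \sum_(i < d.+1) v i * (nsurj i.+1 j.+1)%:R) ->
  [/\ size (hpoly d v) = d, (hpoly d v)`_0 = v 0%N & (hpoly d v)`_d.-1 = v 0%N].
Proof.
case: d => // d _ vd v0 vE.
pose q : {poly F} := \sum_(j < d.+2) v j *: 'X^(j.+1).
have qj j : q`_j = if (0 < j <= d.+2)%N then v j.-1 else 0.
  rewrite coef_sum; case: ifP => rj.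
    have ltj : (j.-1 < d.+2)%N by lia.
    rewrite (bigD1 (Ordinal ltj)) //= coefZ coefXn prednK ?eqxx ?mulr1; last by lia.
    rewrite big1 ?addr0 // => i; rewrite -val_eqE /= => ij.
    rewrite coefZ coefXn; case: eqP => [e|]; rewrite ?mulr0 //.
    by move: ij; rewrite e /= eqxx.
  rewrite big1 // => i _; rewrite coefZ coefXn; case: eqP => [e|]; rewrite ?mulr0 //.
  by have := ltn_ord i; lia.
have szq : size q = d.+3.
  apply/eqP; rewrite eqn_leq; apply/andP; split.
    apply/leq_sizeP => j ltj; rewrite qj; case: ifP => //; lia.
  by rewrite ltnNge; apply/negP => /leq_sizeP/(_ d.+2 (leqnn _)); rewrite qj leqnn /= => /eqP; rewrite (negPf vd).
(* Expanding [X^(i+1)] in binomial polynomials by [X_nsurj] turns the eigenvector equation of [v]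
   into this one. *)
have qE : q = d.+2`!%:R *: umbral q.
  rewrite [in RHS]/q [umbral (\sum_(_ < _) _)]linear_sum /= scaler_sumr.
  under [RHS]eq_bigr => j _.
    rewrite linearZ /= umbralXn scalerA vE ?scaler_suml; last by rewrite -ltnS ltn_ord.
    over.
  rewrite exchange_big; apply: eq_bigr => i _ /=.
  rewrite X_nsurj big_ord_recl /= scale0r add0r scaler_sumr.
  rewrite (@big_ord_trunc _ _ _ i.+1 d.+2 (fun j => v i *: ((nsurj i.+1 j.+1)%:R *: binp F j.+1))).
    by apply: eq_bigr => j _; rewrite scalerA.
  move=> j /orP ltj; rewrite nsurj_small ?scale0r ?scaler0 //.
  by have := ltn_ord i; lia.
have := umbral_eigen_reflect szq isT qE => qR.
(* [q] vanishes at 0, hence by reflection at -1. The sum is [- q(-1)], and up to sign the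
   coefficient of degree [d+1] of [hpoly]. *)
have sum0 : \sum_(j < d.+2) (-1) ^+ j * v j = 0.
  have := congr1 (fun p : {poly F} => p.[0]) qR.
  rewrite horner_coef0 qj /= hornerZ horner_comp !hornerE /=.
  move/esym/eqP; rewrite mulf_eq0 signr_eq0 /= => /eqP.
  rewrite horner_sum => e; apply: oppr_inj; rewrite oppr0 -[RHS]e -sumrN.
  apply: eq_bigr => j _; rewrite hornerZ hornerXn. by rewrite subr0 exprS mulN1r mulrN mulrC.
(* Differentiating the reflection formula at 0 compares [q'(0) = v 0] with [q'(-1)], which is this
   sum. *)
have sum1 : \sum_(j < d.+2) (-1) ^+ j * v j * j.+1%:R = (-1) ^+ d.+1 * v 0%N.
  have := congr1 (fun p : {poly F} => (p^`()).[0]) qR.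
  rewrite derivZ deriv_comp horner_coef0 coef_deriv qj /= mulr1n.
  rewrite hornerZ hornerM horner_comp !hornerE derivB derivX derivN derivC !hornerE /=.
  have dq : q^`().[-1] = \sum_(j < d.+2) (-1) ^+ j * v j * j.+1%:R.
    rewrite /q linear_sum horner_sum /=; apply: eq_bigr => j _.
    by rewrite derivZ derivXn hornerZ hornerMn hornerXn -mulr_natr mulrA [v j * _]mulrC.
  rewrite subr0 dq => ->; rewrite oppr0 sub0r mulrN1 [(-1) ^+ d.+2]exprS.
  by rewrite mulN1r mulNr opprK [RHS]mulrA -expr2 sqrr_sign mul1r.
have top : (hpoly d.+1 v)`_d.+1 = 0 by rewrite hpoly_d sum0 mulr0.
have sub : (hpoly d.+1 v)`_d = v 0%N.
  (* The weight [d+1-j] is split as [(d+2) - (j+1)], which reduces to [sum0] and [sum1]. *)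
  rewrite hpoly_d1 (eq_bigr (fun j : 'I_d.+2 => (-1) ^+ j * v j * d.+2%:R - (-1) ^+ j * v j * j.+1%:R)).
    rewrite sumrB sum1 -mulr_suml sum0 mul0r sub0r exprS mulN1r mulNr opprK.
    by rewrite mulrA -expr2 sqrr_sign mul1r.
  move=> j _; rewrite -mulrBr -natrB; first by rewrite subSS.
  exact: ltn_ord.
split=> //; last exact: hpoly_0.
apply/eqP; rewrite eqn_leq; apply/andP; split.
  apply/leq_sizeP => j; rewrite leq_eqVlt => /predU1P[<-//|ltdj].
  by apply: nth_default; rewrite (leq_trans (size_hpoly _ _)).
by rewrite ltnNge; apply/negP => /leq_sizeP/(_ d (leqnn _)); rewrite sub => /eqP; rewrite (negPf v0).
Qed.
End Symmetry.

(** * Limits of linear recursions with a triangular matrix *)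

Section Limits.
Variable R : realType.

(** The distance to the fixed point [L] of [u |-> a u + l] shrinks by the factor [a] at each step,
    up to the error of [e]. *)
Lemma cvg_affine_rec (u e : nat -> R) (a l : R) :
    0 <= a < 1 -> (forall k, u k.+1 = a * u k + e k) ->
    e k @[k --> \oo] --> l -> u k @[k --> \oo] --> l / (1 - a).
Proof.
move=> /andP[a0 a1] uS el; have a1' : 0 < 1 - a by rewrite subr_gt0.
apply/cvgrPdist_lt => eps eps0.
set L := l / (1 - a).
have LE : L = a * L + l by rewrite /L; field; rewrite gt_eqF.
(* Chosen so that [a (eps / 2) + eps (1 - a) / 2 = eps / 2], which makes [bound] stable under the
   recursion. *)
have eta0 : 0 < eps * (1 - a) / 2 by rewrite divr_gt0 ?mulr_gt0.
have /cvgrPdist_lt/(_ _ eta0) [K _ eK] := el.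
have bound n : `|u (K + n)%N - L| <= a ^+ n * `|u K - L| + eps / 2.
  elim: n => [|n IHn].
    by rewrite addn0 expr0 mul1r lerDl divr_ge0 // ltW.
  have -> : u (K + n.+1)%N - L = a * (u (K + n)%N - L) + (e (K + n)%N - l).
    by rewrite addnS uS {1}LE; ring.
  rewrite (le_trans (ler_normD _ _)) // normrM (ger0_norm a0) [X in _ + X]distrC.
  have /ltW ele := eK (K + n)%N (leq_addr _ _).
  rewrite (le_trans (lerD (ler_wpM2l a0 IHn) ele)) //.
  by rewrite exprS; lra.
have an0 : a ^+ n * `|u K - L| @[n --> \oo] --> 0.
  rewrite -[X in _ --> X](mul0r `|u K - L|); apply: cvgM; last exact: cvg_cst.
  by apply: cvg_expr; rewrite ger0_norm.
have eps2 : 0 < eps / 2 by rewrite divr_gt0.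
have /cvgrPdist_lt/(_ _ eps2) [N _ aN] := an0.
exists (K + N)%N => // k /= leNk.
have leKk : (K <= k)%N by rewrite (leq_trans _ leNk) ?leq_addr.
have leNk' : (N <= k - K)%N by rewrite leq_subRL.
have := aN _ leNk'; rewrite /= sub0r normrN => lta.
rewrite distrC -(subnKC leKk) (le_lt_trans (bound _)) //.
rewrite [ltRHS]splitr ltrD2r (le_lt_trans _ lta) //.
exact: ler_norm.
Qed.

(** Descending from [j = d], component [j] over [M^k] obeys an affine recursion of ratio
    [s j j / M < 1], whose forcing term involves only components of higher index, already known to
    converge. *)
Lemma cvg_triangular_rec d (x : nat -> nat -> R) (s : nat -> nat -> R) (M : R) :
    (forall j, (j < d)%N -> 0 <= s j j < M) ->
    (forall i j, (i < j)%N -> s i j = 0) -> 0 < M ->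
    (forall k, x k d = M ^+ k * x 0%N d) ->
    (forall k j, (j <= d)%N -> x k.+1 j = \sum_(i < d.+1) x k i * s i j) ->
  exists v : nat -> R, forall j, (j <= d)%N -> x k j / M ^+ k @[k --> \oo] --> v j.
Proof.
move=> sjj stri M0 xd xS.
have Mk k : M ^+ k != 0 by rewrite expf_neq0 // gt_eqF.
suff cv j : (j <= d)%N -> exists l : R, x k j / M ^+ k @[k --> \oo] --> l.
  pose v j := match pselect (j <= d)%N with left h => projT1 (cid (cv j h)) | _ => 0 end.
  exists v => j led; rewrite /v; case: pselect => // h; exact: (projT2 (cid (cv j h))).
have [m] : {m | d <= j + m}%N by exists d; rewrite leq_addl.
elim/ltn_ind: m j => m IHm j lem lejd.
have [ltjd|ledj] := ltnP j d; last first.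
  exists (x 0%N d); rewrite (_ : j = d); last by apply/eqP; rewrite eqn_leq lejd.
  under eq_fun do rewrite xd mulrAC divff // mul1r.
  exact: cvg_cst.
have cvi i : (j < i)%N -> (i <= d)%N -> exists l : R, x k i / M ^+ k @[k --> \oo] --> l.
  by move=> ltji leid; apply: (IHm (m.-1)) => //; lia.
pose w i := match pselect (j < i <= d)%N with
  | left h => projT1 (cid (cvi i (andP h).1 (andP h).2)) | _ => 0 end.
have wP i : (j < i)%N -> (i <= d)%N -> x k i / M ^+ k @[k --> \oo] --> w i.
  move=> h1 h2; rewrite /w; case: pselect => [h|[]]; last by rewrite h1.
  exact: (projT2 (cid (cvi i (andP h).1 (andP h).2))).
exists ((\sum_(i < d.+1 | (j < i)%N) w i * s i j / M) / (1 - s j j / M)).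
apply: (@cvg_affine_rec _ (fun k => \sum_(i < d.+1 | (j < i)%N) x k i / M ^+ k * s i j / M)).
- have /andP[s0 sM] := sjj j ltjd.
  by apply/andP; split; [rewrite divr_ge0 // ltW | rewrite ltr_pdivrMr // mul1r].
- move=> k; rewrite xS // (bigD1 (Ordinal (ltnW ltjd : (j < d.+1)%N))) //=.
  rewrite (bigID (fun i : 'I__ => (j < i)%N)) /= [X in _ + (_ + X)]big1 ?addr0 => [|i]; last first.
    rewrite -leqNgt -val_eqE /= => /andP[ne le]; rewrite stri ?mulr0 //.
    by rewrite ltn_neqAle ne.
  rewrite mulrDl exprS; congr (_ + _); first by field; rewrite Mk gt_eqF.
  rewrite mulr_suml; apply: eq_big => [i|i _]; last by field; rewrite Mk gt_eqF.
  by rewrite -val_eqE /=; lia.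
- apply: cvg_big => [|i ltji]; first exact: add_continuous.
  by do 2 apply: cvgM (cvg_cst _) => /=; apply: wP => //; rewrite -ltnS.
Qed.

Lemma cvg_real_complex (u : nat -> R) (l : R) :
  u k @[k --> \oo] --> l ->
  (real_complex R (u k) : cplx R) @[k --> \oo] --> (real_complex R l : cplx R).
Proof.
(* A positive [eps] in [cplx R] has zero imaginary part, so its real part serves in [R]. *)
move=> ul; apply/cvgrPdist_lt => eps; rewrite ltcE /= => /andP[/eqP im0 re0].
have /cvgrPdist_lt/(_ _ re0) := ul; apply: filterS => k.
rewrite -rmorphB /= normc_def /= expr0n addr0 sqrtr_sqr => lt_eps.
by rewrite ltcE /= im0 eqxx.
Qed.

(** Passage to the limit in the recursion divided by [M^k]. *)
Lemma triangular_eigen d (x : nat -> nat -> R) (s : nat -> nat -> R) (M : R) (v : nat -> R) :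
    0 < M ->
    (forall k j, (j <= d)%N -> x k.+1 j = \sum_(i < d.+1) x k i * s i j) ->
    (forall j, (j <= d)%N -> x k j / M ^+ k @[k --> \oo] --> v j) ->
  forall j, (j <= d)%N -> M * v j = \sum_(i < d.+1) v i * s i j.
Proof.
move=> M0 xS xv j lejd.
have shifted : M * (x k.+1 j / M ^+ k.+1) @[k --> \oo] --> M * v j.
  apply: cvgM; first exact: cvg_cst.
  by have := xv j lejd; rewrite -(cvg_shiftS (fun k => x k j / M ^+ k)).
apply: cvg_unique shifted _; first exact: norm_hausdorff.
have e k : M * (x k.+1 j / M ^+ k.+1) = \sum_(i < d.+1) x k i / M ^+ k * s i j.
  rewrite xS // exprS invfM mulrCA mulVKf ?gt_eqF // mulr_suml.
  by apply: eq_bigr => i _; rewrite mulrAC.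
rewrite /=; under eq_fun do rewrite e.
apply: cvg_big => [|i _]; first exact: add_continuous.
apply: cvgM; last exact: cvg_cst.
by apply: xv; rewrite -ltnS.
Qed.
End Limits.

Section SdLimits.
Context (R : realType) {disp : Order.disp_t} (P : finPOrderType disp) (d : nat).
Hypotheses (hdim : poset_dim P = d) (hd : (0 < d)%N).

Lemma num_chains_top_gt0 k : (0 < num_chains (iter_Sd k P) d)%N.
Proof.
rewrite (num_chains_iter_top _ hdim) muln_gt0 expn_gt0 fact_gt0 -hdim.
by rewrite num_chains_dim // hdim.
Qed.

Lemma num_chains_limit : exists v : nat -> R,
  [/\ forall j, (j <= d)%N ->
        (num_chains (iter_Sd k P) j)%:R / d.+1`!%:R ^+ k @[k --> \oo] --> v j,
      size (hpoly d v) = d,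
      (hpoly d v)`_0 != 0 & (hpoly d v)`_d.-1 = (hpoly d v)`_0].
Proof.
pose x k j : R := (num_chains (iter_Sd k P) j)%:R.
pose s i j : R := (nsurj i.+1 j.+1)%:R.
pose M : R := d.+1`!%:R.
have M0 : 0 < M by rewrite ltr0n fact_gt0.
have xS k j : (j <= d)%N -> x k.+1 j = \sum_(i < d.+1) x k i * s i j.
  move=> _; rewrite /x (num_chains_iterS _ _ hdim) natr_sum.
  by apply: eq_bigr => i _; rewrite natrM.
have xd k : x k d = M ^+ k * x 0%N d.
  by rewrite /x (num_chains_iter_top _ hdim) natrM natrX.
have [|||||v xv] := @cvg_triangular_rec R d x s M.
- move=> j ltjd; rewrite ler0n ltr_nat nsurjnn ltn_fact //.
- by move=> i j ltij; rewrite /s nsurj_small.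
- exact: M0.
- exact: xd.
- exact: xS.
have vE := triangular_eigen M0 xS xv.
have v_ge0 j : (j <= d)%N -> 0 <= v j.
  move=> lejd; have xvj := xv j lejd.
  rewrite -(cvg_lim _ xvj) //; apply: limr_ge; first by apply/cvg_ex; exists (v j).
  by apply: nearW => k; rewrite divr_ge0 ?exprn_ge0 // ltW.
have vd : v d = x 0%N d.
  have := xv d (leqnn _).
  under eq_fun do rewrite xd mulrAC divff ?mul1r ?expf_neq0 ?gt_eqF //.
  move=> e; apply: cvg_unique e (cvg_cst _); exact: norm_hausdorff.
have vd0 : 0 < v d by rewrite vd ltr0n (num_chains_top_gt0 0).
(* The equation for [j = 0] has nonnegative terms on the right, and the last one is [v d > 0], there
   being a single surjection onto a point. *)
have v00 : 0 < v 0%N.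
  rewrite -(pmulr_rgt0 _ M0) vE // big_ord_recr /= ltr_wpDl //.
    by apply: sumr_ge0 => i _; rewrite mulr_ge0 ?ler0n // v_ge0 // ltnW // ltn_ord.
  by rewrite mulr_gt0 // /s nsurj_1.
have [|||szH H0 Hd] := @hpoly_eigen R d v hd.
- by rewrite gt_eqF.
- by rewrite gt_eqF.
- exact: vE.
exists v; split=> //; last by rewrite Hd H0.
by rewrite H0 gt_eqF.
Qed.
End SdLimits.

(** * Labelling of the zeros and reality of the dominant one *)

Section Zeros.
Variable C : numClosedFieldType.

Lemma hpolyZ d (a : C) v : hpoly d (fun j => a * v j) = a *: hpoly d v.
Proof. by rewrite /hpoly scaler_sumr; apply: eq_bigr => j _; rewrite scalerA. Qed.

Lemma cvg_hpoly d (y : nat -> nat -> C) (v : nat -> C) :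
    (forall j, (j <= d)%N -> y k j @[k --> \oo] --> v j) ->
  cvg_coef (fun k => hpoly d (y k)) (hpoly d v).
Proof.
move=> yv i; rewrite coef_sum; under eq_fun do rewrite coef_sum.
apply: cvg_big => [|j _]; first exact: add_continuous.
rewrite coefZ; under eq_fun do rewrite coefZ.
by apply: cvgM (cvg_cst _); apply: yv; rewrite -ltnS.
Qed.

Lemma labelled_roots d (p : {poly C}) : size p = d.+1 -> (0 < d)%N ->
  exists2 b : nat -> C,
    p %= \prod_(z <- [seq b i | i <- index_iota 1 d.+1]) ('X - z%:P) &
    forall i, (1 <= i <= d)%N -> `|b i| <= `|b 1%N|.
Proof.
move=> szp d0; have [r pE] := closed_field_poly_normal p.
have lp0 : lead_coef p != 0 by rewrite lead_coef_eq0 -size_poly_eq0 szp.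
have szr : size r = d.
  by have := szp; rewrite {1}pE size_scale // size_prod_XsubC => -[].
(* Minimising the opposite of the modulus selects a root of largest modulus, to be placed first. *)
have [||x xr xmin] := @seq_min _ _ (fun z => - `|z|) r.
- by move=> z; rewrite rpredN normr_real.
- by rewrite -size_eq0 szr -lt0n.
pose s := x :: rem x r.
have szs : size s = d by rewrite /= size_rem // szr prednK.
have sE : [seq nth 0 s i.-1 | i <- index_iota 1 d.+1] = s.
  rewrite /index_iota -(addn0 1%N) iotaDl -map_comp -[RHS](mkseq_nth 0) szs /mkseq.
  by rewrite addn0 subn1; apply: eq_map.
exists (fun i => nth 0 s i.-1).
  rewrite sE pE (perm_big _ (perm_to_rem xr)) /=.
  by rewrite (eqp_trans (eqp_scale _ lp0)) ?eqpxx.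
move=> i ri /=; rewrite -[leLHS]opprK lerNl xmin //.
by rewrite (perm_mem (perm_to_rem xr)) mem_nth // -/s szs; lia.
Qed.

Lemma dominant_root_real d (p : {poly C}) (b : nat -> C) : (0 < d)%N ->
    map_poly Num.conj p = p ->
    p %= \prod_(i <- index_iota 1 d.+1) ('X - (b i)%:P) ->
    (forall i, (2 <= i <= d)%N -> `|b i| < `|b 1%N|) ->
  b 1%N \is Num.real.
Proof.
move=> d0 pJ pE blt.
have root_b z : root p z = (z \in [seq b i | i <- index_iota 1 d.+1]).
  by rewrite (eqp_root pE) -(big_map b xpredT (fun x => 'X - x%:P)) root_prod_XsubC.
have /rootP pb1 : root p (b 1%N).
  by rewrite root_b; apply/mapP; exists 1%N => //; rewrite mem_index_iota.
(* The conjugate of [b 1] is a root of the same modulus; a label [i >= 2] would make its modulus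
   strictly smaller. *)
have /mapP[i ri bi] : Num.conj (b 1%N) \in [seq b i | i <- index_iota 1 d.+1].
  by rewrite -root_b -pJ rootE horner_map /= pb1 rmorph0.
rewrite mem_index_iota in ri.
apply/CrealP; rewrite bi; congr b; apply/eqP; move: ri; rewrite ltnS leq_eqVlt.
case/andP=> /predU1P[->//|i1 id].
have := blt i; rewrite i1 id => /(_ isT).
by rewrite -bi norm_conjC ltxx.
Qed.
End Zeros.

Theorem theorem1p1 (R : realType) (disp : Order.disp_t)
    (P : finPOrderType disp) (d : nat) (hdim : poset_dim P = d)
    (hd : (1 <= d)%N) (hchi : euler_char P <> 0) :
  (exists beta : nat -> nat -> cplx R,
     forall k, labelled_zeros (iter_Sd k P) d (beta k)) /\
  (forall beta : nat -> nat -> cplx R,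
     (forall k, labelled_zeros (iter_Sd k P) d (beta k)) ->
     [/\ `|beta k 1%N| @[k --> \oo] --> +oo,
         (exists gamma : nat -> nat -> cplx R,
            (forall k, perm_eq [seq gamma k i | i <- index_iota 2 d.+1]
                               [seq beta k i | i <- index_iota 2 d.+1]) /\
            (forall i, (2 <= i <= d)%N -> cvg (gamma k i @[k --> \oo]))),
         (\forall k \near \oo, beta k 1%N \is Num.real)
       & \prod_(2 <= i < d.+1) beta k i @[k --> \oo]
           --> ((-1) ^+ d.-1 : cplx R)]).
Proof.
pose C := cplx R; pose iota : {rmorphism R -> C} := real_complex R.
pose c k j : C := (num_chains (iter_Sd k P) j)%:R.
have c_pos k j : (0 < num_chains (iter_Sd k P) j)%N -> c k j != 0.
  by rewrite pnatr_eq0 -lt0n.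
have zerosP k s : zeta_zeros (iter_Sd k P) s <->
    hpoly d (c k) %= \prod_(z <- s) ('X - z%:P).
  apply: zeta_zerosP => [i|]; first exact: num_chains_iter_gt.
  by apply: c_pos; apply: num_chains_top_gt0.
split.
  have /choice [beta betaP] k : exists b : nat -> C, labelled_zeros (iter_Sd k P) d b.
    (* A nonzero Euler characteristic, preserved by subdivision, gives the numerator degree exactly
       [d], hence [d] zeros. *)
    have chi_d : (hpoly d (c k))`_d != 0.
      rewrite hpoly_d mulf_eq0 signr_eq0 /=.
      have -> : \sum_(j < d.+1) (-1) ^+ j * c k j = (euler_char P)%:~R.
        rewrite -(euler_iter k hdim) rmorph_sum; apply: eq_bigr => j _.
        by rewrite rmorphM rmorphXn /= rmorphN1.
      by rewrite intr_eq0; apply/eqP.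
    have szh : size (hpoly d (c k)) = d.+1.
      apply/eqP; rewrite eqn_leq size_hpoly ltnNge; apply/negP => /leq_sizeP.
      by move=> /(_ d (leqnn _)) e; rewrite e eqxx in chi_d.
    have [b bE bmax] := labelled_roots szh hd.
    by exists b; split; first exact/zerosP.
  by exists beta.
move=> b bP.
have [v [vlim szv v0 vd]] := num_chains_limit R hdim hd.
pose M : C := d.+1`!%:R.
have M0 k : M ^+ k != 0 by rewrite expf_neq0 // pnatr_eq0 -lt0n fact_gt0.
(* Dividing by [(d+1)!^k] keeps the roots and makes the coefficients converge. *)
pose h k := hpoly d (fun j => (M ^+ k)^-1 * c k j).
pose H := hpoly d (iota \o v).
have HE : H = map_poly iota (hpoly d v) by rewrite map_hpoly.
have bE k : hpoly d (c k) %= \prod_(i <- index_iota 1 d.+1) ('X - (b k i)%:P).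
  by have [/zerosP] := bP k; rewrite big_map.
have hH : cvg_coef h H.
  apply: cvg_hpoly => j lejd.
  have := cvg_real_complex (vlim j lejd).
  have e k : real_complex R ((num_chains (iter_Sd k P) j)%:R / d.+1`!%:R ^+ k) =
      (M ^+ k)^-1 * c k j.
    by rewrite rmorphM fmorphV rmorphXn !rmorph_nat mulrC.
  by under eq_fun do rewrite e.
have hE k : h k %= \prod_(i <- index_iota 1 d.+1) ('X - (b k i)%:P).
  by rewrite /h hpolyZ (eqp_trans (eqp_scale _ _)) ?invr_eq0.
have h0 k : (h k)`_0 != 0.
  rewrite hpoly_0 mulf_neq0 ?invr_eq0 // c_pos //.
  by apply: (@num_chains_0 _ _ d); apply: num_chains_top_gt0.
have bmax k i : (1 <= i <= d)%N -> `|b k i| <= `|b k 1%N| by have [_] := bP k; apply.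
have H0 : H`_0 != 0 by rewrite HE coef_map fmorph_eq0.
have szH : size H = d by rewrite HE size_map_poly.
have [boo [g [gb gcvg blt]] prodb] := roots_degree_drop hd hH hE bmax h0 H0 szH.
split.
- exact: boo.
- by exists g.
(* The unnormalised numerator has integer coefficients, so conjugation fixes it. *)
- apply: filterS blt => k; apply: (@dominant_root_real _ d (hpoly d (c k))) => //.
  rewrite map_hpoly; congr hpoly; apply/funext => j.
  by rewrite /= rmorph_nat.
(* The two extreme coefficients of [H] agree, so their ratio is 1 and only the sign remains. *)
- move: prodb; rewrite HE !coef_map vd divff ?mulr1 ?fmorph_eq0 //.
Qed.
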